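(* Let $A$ be an $m\times n$ sensing matrix with $2m\le n$, let the representation structure be such that $B=I_n$, $n_k=d$ and $\|\cdot\|_{(k)}=\|\cdot\|_r$ for $1\le k\le K$ (so $n=Kd$), with $r\in\{1,2,\infty\}$, and let $s\le K$ be a positive integer. Whenever an $m\times n$ matrix $H$ and an $n\times n$ matrix $V=[V^{k\ell}]_{k,\ell=1}^K$ with $d\times d$ blocks $V^{k\ell}$ satisfy $$I=V+H^TA\qquad\text{and}\qquad\max_{1\le\ell\le K}\big\|\big[\|V^{1\ell}\|_{r,r};\|V^{2\ell}\|_{r,r};\dots;\|V^{K\ell}\|_{r,r}\big]\big\|_{s,q}\le\frac12s^{1/q-1}$$ with some $q\ge1$ ($q\in[1,\infty]$), one has $$s\le\frac{3\sqrt{m}}{2\sqrt{d}}.$$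
   Context: $\|M\|_{r,r}=\max_{\|u\|_r\le1}\|Mu\|_r$ is the operator norm induced by the $\ell_r$-norm on the argument and image spaces. For a vector $u\in\mathbb{R}^K$, $\|u\|_{s,q}$ is the $\ell_q$-norm of the vector obtained from $u$ by zeroing all but the $s$ largest in magnitude entries. Convention: $1/\infty=0$. Vectors in $\mathbb{R}^n$ are split into $K$ consecutive blocks of dimension $d$ each, and $V$ is partitioned accordingly. *)

(* Defs.v *)
From HB Require Import structures.
From mathcomp Require Export all_boot all_order all_algebra.
From mathcomp Require Export boolp classical_sets reals ereal topology normedtype exp.

Set Implicit Arguments.
Unset Strict Implicit.
Unset Printing Implicit Defensive.

Import Order.TTheory GRing.Theory Num.Theory.

Local Open Scope ring_scope.

(* Meaningful for 1 <= p <= +oo; the value at -oo is junk. *)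
Definition lnorm (R : realType) (p : \bar R) (n : nat) (u : 'cV[R]_n) : R :=
  match p with
  | p'%:E => (\sum_(i < n) `|u i 0| `^ p') `^ p'^-1
  | +oo%E => \big[Num.max/0]_(i < n) `|u i 0|
  | -oo%E => 0
  end.

(* The set is nonempty and, for 1 <= r <= +oo, compact, so that this supremum
   is the maximum. *)
Definition opnorm (R : realType) (r : \bar R) (m n : nat) (M : 'M[R]_(m, n)) : R :=
  sup [set lnorm r (M *m u) | u in [set u : 'cV[R]_n | lnorm r u <= 1]]%classic.

(* Position, from 0, of entry i when the entries are listed by nonincreasing
   magnitude, ties being broken by the index. *)
Definition mag_rank (R : realType) (K : nat) (u : 'cV[R]_K) (i : 'I_K) : nat :=
  #|[set j : 'I_K | (`|u i 0| < `|u j 0|)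
                    || (`|u j 0| == `|u i 0|) && (j < i)%N]|.

Definition largest (R : realType) (s K : nat) (u : 'cV[R]_K) : 'cV[R]_K :=
  \col_i (if (mag_rank u i < s)%N then u i 0 else 0).

Definition sqnorm (R : realType) (s : nat) (q : \bar R) (K : nat)
    (u : 'cV[R]_K) : R :=
  lnorm q (largest s u).

Lemma block_index_subproof (K d : nat) (k : 'I_K) (i : 'I_d) :
  (k * d + i < K * d)%N.
Proof.
apply: (@leq_trans (k.+1 * d)%N); last by rewrite leq_mul2r ltn_ord orbT.
by rewrite mulSn addnC ltn_add2r ltn_ord.
Qed.

Definition block_index (K d : nat) (k : 'I_K) (i : 'I_d) : 'I_(K * d) :=
  Ordinal (block_index_subproof k i).

Definition block (R : realType) (K d : nat) (V : 'M[R]_(K * d)) (k l : 'I_K) :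
    'M[R]_d :=
  mxsub (block_index k) (block_index l) V.

(* Main.v *)
Require Import Defs.
From mathcomp Require Import ring lra zify.

(** Write [V = I - W] with [W = H^T A] of rank at most [m].  The Frobenius
    distance from the identity to a matrix of rank at most [m] is at least
    [sqrt (N - m)] in dimension [N], so [V] cannot be small; the hypothesis on
    the blocks says that it is, and comparing the two bounds limits [s].

    Upper bound.  In each block column, let [v] be the vector of the operator
    norms of the blocks.  The case of a general [q] reduces to [q = 1] by
    Jensen's inequality ([sum_largest_le]): the [s] largest entries of [v] sum to
    at most 1/2.  Hence their squares sum to at most 1/4, and each other entry is
    at most 1/(2s), so any [k] entries of [v] have squares summing to at most
    [1/4 + k/(4s^2)] ([sum_sqr_le_largest]).  For [r = 1, 2, +oo] the squared
    Frobenius norm of a [d x d] block is at most [d] times its squared operator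
    norm ([frobenius_le_opnorm]).

    Lower bound.  If [P] is the orthogonal projector onto the kernel of [A], then
    [V P = P], and expanding [0 <= |V - P|^2] in the Frobenius norm gives
    [|V|^2 >= 	r P >= N - m] ([frobenius_ge]).

    Both bounds hold for the principal submatrix formed by the first [k] block
    rows and columns, because restriction preserves the decomposition.  So
    ([leading_blocks_bound]), for every [k <= K],
      [k d - m <= k d (1/4 + k / (4 s^2))].
    With [k = 1] this gives [d <= 2m].  An integer [k] with
    [2m <= k d <= 4m] then exists, and [2m <= K d] allows taking [k <= K].  With
    [n = k d] the inequality reads [d s^2 (3n - 4m) <= n^2], and
    [n^2 <= (9/4) m (3n - 4m)] when [2m <= n <= 4m], so [4 d s^2 <= 9 m].  Working
    with a number of rows comparable to [m] is what makes the bound independent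
    of the full dimension. *)

Set Implicit Arguments.
Unset Strict Implicit.
Unset Printing Implicit Defensive.

Import Order.TTheory GRing.Theory Num.Theory.
Local Open Scope ring_scope.

(** * Vector norms, operator norms and the Frobenius norm *)

Section Lnorm.
Variables (R : realType) (p : \bar R).
Hypothesis p_ge1 : (1 <= p)%E.

Lemma lnorm_ge_entry n (u : 'cV[R]_n) i : `|u i 0| <= lnorm p u.
Proof.
case: p p_ge1 => [p'| |] //=; last by move=> _; exact: le_bigmax.
rewrite lee_fin => p'1; have p'0 : 0 < p' by apply: lt_le_trans p'1.
have pw t : 0 <= t -> (t `^ p') `^ p'^-1 = t :> R.
  by move=> t0; rewrite -powRrM divff ?gt_eqF // powRr1.
rewrite -[leLHS]pw //; apply: ge0_ler_powR.
- by rewrite invr_ge0 ltW.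
- by rewrite nnegrE powR_ge0.
- by rewrite nnegrE sumr_ge0 // => j _; rewrite powR_ge0.
- by rewrite (bigD1 i) //= lerDl sumr_ge0 // => j _; rewrite powR_ge0.
Qed.

Lemma ler_lnorm n (u v : 'cV[R]_n) :
  (forall i, `|u i 0| <= `|v i 0|) -> lnorm p u <= lnorm p v.
Proof.
move=> uv; case: p p_ge1 => [p'|_|]; last 2 first.
- by apply: le_bigmax2 => i _; exact: uv.
- by [].
rewrite lee_fin => p'1; have p'0 : 0 <= p' by apply: le_trans p'1.
apply: ge0_ler_powR; rewrite ?nnegrE ?invr_ge0 //;
  try by apply: sumr_ge0 => j _; rewrite powR_ge0.
by apply: ler_sum => i _; apply: ge0_ler_powR; rewrite ?nnegrE.
Qed.

(** [opnorm] is a supremum of reals, hence only meaningful once the set is known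
    to be bounded.  Entries of a vector in the unit ball are at most 1 in
    absolute value, so the image is dominated entrywise by the vector of absolute
    row sums of [M]. *)
Lemma lnorm_le_opnorm m n (M : 'M[R]_(m, n)) (u : 'cV[R]_n) :
  lnorm p u <= 1 -> lnorm p (M *m u) <= opnorm p M.
Proof.
move=> u1; rewrite /opnorm; apply: ub_le_sup; last by exists u.
exists (lnorm p (\col_i \sum_j `|M i j|)) => _ [v /= v1 <-].
apply: ler_lnorm => i; rewrite !mxE.
rewrite (le_trans (ler_norm_sum _ _ _)) // [leRHS]ger0_norm ?sumr_ge0 //.
apply: ler_sum => j _; rewrite normrM ler_piMr //.
exact: le_trans (lnorm_ge_entry v j) v1.
Qed.

End Lnorm.

Lemma sum_sqr_le_sqr_sum (R : realDomainType) (I : finType) (P : pred I)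
    (F : I -> R) :
  \sum_(i | P i) F i ^+ 2 <= (\sum_(i | P i) `|F i|) ^+ 2.
Proof.
rewrite expr2 mulr_suml; apply: ler_sum => i Pi.
rewrite -real_normK ?num_real // expr2 ler_wpM2l // (bigD1 i) //= lerDl.
by rewrite sumr_ge0.
Qed.

Lemma lnorm1_delta (R : realType) n (j : 'I_n) :
  lnorm 1%:E (delta_mx j 0 : 'cV[R]_n) = 1.
Proof.
rewrite /= invr1 powRr1; last by rewrite sumr_ge0 // => i _; rewrite powR_ge0.
rewrite (bigD1 j) //= big1 ?addr0 => [|i ij]; rewrite powRr1 // mxE eqxx.
  by rewrite eqxx normr1.
by rewrite (negbTE ij) normr0.
Qed.

Lemma lnorm2_delta (R : realType) n (j : 'I_n) :
  lnorm 2%:E (delta_mx j 0 : 'cV[R]_n) = 1.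
Proof.
rewrite /= (bigD1 j) //= big1 ?addr0 => [|i ij]; rewrite powR_mulrn // mxE eqxx.
  by rewrite eqxx normr1 expr1n powR1.
by rewrite (negbTE ij) normr0 expr0n.
Qed.

(** For [r = 1] and [r = 2] the test vectors are the basis vectors: a column has
    l2-norm at most its l1-norm, and is an image of the unit ball.  For
    [r = +oo] the test vector is the sign pattern of a row, which recovers the
    l1-norm of that row. *)
Lemma frobenius_le_opnorm (R : realType) (r : \bar R) d (M : 'M[R]_d) :
  r = 1%:E \/ r = 2%:E \/ r = +oo%E ->
  \sum_i \sum_j M i j ^+ 2 <= d%:R * opnorm r M ^+ 2.
Proof.
have cst c : d%:R * c = \sum_(i < d) c by rewrite sumr_const card_ord mulr_natl.
rewrite cst; case=> [->|[->|->]].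
- rewrite exchange_big; apply: ler_sum => j _.
  apply: le_trans (sum_sqr_le_sqr_sum _ _) _.
  have := @lnorm_le_opnorm R 1%:E (lexx _) _ _ M (delta_mx j 0).
  rewrite lnorm1_delta lexx => /(_ isT).
  rewrite -colE /= invr1 powRr1; last first.
    by rewrite sumr_ge0 // => i _; rewrite powR_ge0.
  under eq_bigr do rewrite powRr1 // mxE.
  by move=> h; rewrite lerXn2r ?nnegrE ?(le_trans _ h) ?sumr_ge0.
- rewrite exchange_big; apply: ler_sum => j _.
  have r2 : (1 <= 2%:E :> \bar R)%E by rewrite lee_fin ler1n.
  have := @lnorm_le_opnorm R _ r2 _ _ M (delta_mx j 0).
  rewrite lnorm2_delta lexx => /(_ isT).
  rewrite -colE /=; set S := (X in X `^ _).
  have -> : S = \sum_i M i j ^+ 2.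
    by apply: eq_bigr => i _; rewrite powR_mulrn // real_normK ?num_real // mxE.
  have S0 : 0 <= \sum_i M i j ^+ 2 by rewrite sumr_ge0 // => i _; rewrite sqr_ge0.
  rewrite powR12_sqrt // => h.
  by rewrite -[leLHS]sqr_sqrtr // lerXn2r ?nnegrE ?(le_trans _ h) ?sqrtr_ge0.
- apply: ler_sum => i _; apply: le_trans (sum_sqr_le_sqr_sum _ _) _.
  have rge1 : (1 <= +oo :> \bar R)%E by exact: leey.
  pose u : 'cV[R]_d := \col_j Num.sg (M i j).
  have u1 : lnorm +oo%E u <= 1.
    by apply: bigmax_le => // j _; rewrite mxE normr_sg lern1; case: eqP.
  have h := le_trans (lnorm_ge_entry rge1 (M *m u) i) (lnorm_le_opnorm rge1 M u1).
  have e : (M *m u) i 0 = \sum_j `|M i j|.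
    by rewrite mxE; apply: eq_bigr => j _; rewrite mxE mulrC -normrEsg.
  rewrite e ger0_norm ?sumr_ge0 // in h.
  by rewrite lerXn2r ?nnegrE ?(le_trans _ h) ?sumr_ge0.
Qed.

(** * The largest entries of a vector *)

Section Rank.
Variables (R : realType) (K : nat) (u : 'cV[R]_K).

Lemma mag_rank_lt (i j : 'I_K) :
  (`|u i 0| < `|u j 0|) || (`|u j 0| == `|u i 0|) && (j < i)%N ->
  (mag_rank u j < mag_rank u i)%N.
Proof.
move=> ji; apply/proper_card/properP; split; last first.
  by exists j; rewrite inE ?ltxx ?ltnn ?andbF.
apply/fintype.subsetP => k; rewrite !inE.
case/orP: ji => [ij|/andP[/eqP-> ji]]; case/orP => [jk|/andP[/eqP-> kj]].
- by rewrite (lt_trans ij jk).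
- by rewrite ij.
- by rewrite jk.
- by rewrite eqxx (ltn_trans kj ji) orbT.
Qed.

Lemma mag_rank_bound (i : 'I_K) : (mag_rank u i < K)%N.
Proof.
rewrite -[X in (_ < X)%N]card_ord -cardsT; apply/proper_card/properP.
by split; [exact: finset.subsetT | exists i; rewrite inE ?ltxx ?ltnn ?andbF].
Qed.

Lemma mag_rank_inj : injective (mag_rank u).
Proof.
move=> i j eij; apply: val_inj; apply/eqP; apply: contraT.
have [ij|ij|e] := ltgtP `|u i 0| `|u j 0|.
- by have := @mag_rank_lt i j; rewrite ij eij ltnn => /(_ isT).
- by have := @mag_rank_lt j i; rewrite ij eij ltnn => /(_ isT).
- rewrite neq_ltn => /orP[] h.
    by have := @mag_rank_lt j i; rewrite e eqxx h orbT eij ltnn => /(_ isT).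
  by have := @mag_rank_lt i j; rewrite e eqxx h orbT eij ltnn => /(_ isT).
Qed.

(** Because ties are broken by the index, [mag_rank] is a permutation of the
    indices. *)
Lemma card_largest s : (s <= K)%N -> #|[pred i | (mag_rank u i < s)%N]| = s.
Proof.
move=> sK; pose f i : 'I_K := Ordinal (mag_rank_bound i).
have f_inj : injective f by move=> i j /(congr1 val) /mag_rank_inj.
have f_bij : bijective f by exact: inj_card_bij.
transitivity #|[pred j : 'I_K | (j < s)%N]|.
  by rewrite -!sum1_card [RHS](reindex f) //; exact: onW_bij.
by rewrite -sum1_card (big_ord_narrow sK) sum1_card card_ord.
Qed.

(** An entry outside the [s] largest is at most each of them, hence at most their
    mean, which is at most 1/(2s).  The squares of the [s] largest sum to at most
    the square of their sum. *)
Lemma sum_sqr_le_largest s (P : pred 'I_K) :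
  (0 < s)%N -> (s <= K)%N -> \sum_(i | (mag_rank u i < s)%N) `|u i 0| <= 1 / 2 ->
  \sum_(i | P i) u i 0 ^+ 2 <= 1 / 4 + #|P|%:R / (4 * s%:R ^+ 2).
Proof.
move=> s0 sK top.
have sR0 : 0 < s%:R :> R by rewrite ltr0n.
have small i : (s <= mag_rank u i)%N -> `|u i 0| <= 1 / (2 * s%:R).
  move=> si; rewrite ler_pdivlMr ?mulr_gt0 // mulrCA mulrC -ler_pdivlMr //.
  apply: le_trans top; rewrite mulr_natr.
  rewrite -[X in _ *+ X](card_largest sK) -sumr_const; apply: ler_sum => j js.
  rewrite leNgt; apply/negP => ij; move: js; rewrite inE ltnNge.
  by rewrite (leq_trans si) // ltnW // mag_rank_lt // ij.
set c := (_ / (2 * _)) in small.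
have -> : #|P|%:R / (4 * s%:R ^+ 2) = \sum_(i | P i) c ^+ 2.
  rewrite (sumr_const P) -[RHS]mulr_natl /c; congr (_ * _).
  by field; rewrite gt_eqF.
have h i : u i 0 ^+ 2 <=
    (if (mag_rank u i < s)%N then `|u i 0| ^+ 2 else 0) + c ^+ 2.
  have := ltnP (mag_rank u i) s; case=> si.
    by rewrite real_normK ?num_real // lerDl sqr_ge0.
  rewrite add0r -real_normK ?num_real // lerXn2r ?nnegrE ?small //.
  by rewrite (le_trans _ (small _ si)).
apply: le_trans (ler_sum _ (fun i _ => h i)) _; rewrite big_split lerD2r.
rewrite -big_mkcondr /=.
apply: le_trans (_ : (\sum_(i | (mag_rank u i < s)%N) `|u i 0|) ^+ 2 <= _).
  under [X in _ <= X ^+ 2]eq_bigr do rewrite -normr_id.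
  apply: le_trans (sum_sqr_le_sqr_sum _ _).
  rewrite [leRHS](bigID P) /= (eq_bigl _ _ (fun=> andbC _ _)) lerDl.
  by rewrite sumr_ge0 // => i _; exact: sqr_ge0.
have -> : 1 / 4 = (1 / 2) ^+ 2 :> R by field.
by rewrite lerXn2r ?nnegrE ?sumr_ge0 ?divr_ge0.
Qed.

End Rank.

(** Jensen's inequality for [t `^ q], in tangent form: for a finite [q], sum
    [t `^ q >= 1 + q * (t - 1)] over the [s] largest entries with
    [t = 2 * s * |u_i|].  This scaling is chosen so that the equality case, where
    they all equal 1/(2s), sits at the point of tangency [t = 1]. *)
Lemma sum_largest_le (R : realType) (q : \bar R) s K (u : 'cV[R]_K) :
  (1 <= q)%E -> (0 < s)%N -> (s <= K)%N ->
  sqnorm s q u <= 1 / 2 * s%:R `^ (fine q^-1%E - 1) ->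
  \sum_(i | (mag_rank u i < s)%N) `|u i 0| <= 1 / 2.
Proof.
move=> q1 s0 sK; have sR0 : 0 < s%:R :> R by rewrite ltr0n.
have sumc c : \sum_(i | (mag_rank u i < s)%N) c = s%:R * c :> R.
  by rewrite sumr_const card_largest // mulr_natl.
have entry i : (mag_rank u i < s)%N -> largest s u i 0 = u i 0.
  by move=> si; rewrite mxE si.
rewrite /sqnorm; case: q q1 => [q| |] // q1 h; last first.
  move: h; rewrite invey /= sub0r powR_inv1 ?ler0n // => h.
  apply: le_trans (_ : \sum_(i | (mag_rank u i < s)%N) (1 / 2 / s%:R) <= _).
    apply: ler_sum => i si; apply: le_trans h; rewrite -(entry i si).
    exact: (@lnorm_ge_entry R +oo%E).
  by rewrite sumc mulrC divfK // gt_eqF.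
rewrite lee_fin in q1; have q0 : 0 < q by apply: lt_le_trans q1.
have key i : (mag_rank u i < s)%N ->
  q * (2 * s%:R * `|u i 0| - 1) <= (2 * s%:R * `|u i 0|) `^ q - 1.
  (* Bernoulli's inequality at t, as Young's inequality for the product t * 1 *)
  move=> _; set t := _ * `|_|.
  have t0 : 0 <= t by rewrite !mulr_ge0 // ltW.
  move: q1; rewrite le_eqVlt => /orP[/eqP <-|q1].
    by rewrite mul1r powRr1.
  have q'0 : 0 < q / (q - 1) by rewrite divr_gt0 // subr_gt0.
  have := @conjugate_powR R t 1 q (q / (q - 1)) t0 ler01 q0 q'0.
  rewrite mulr1 powR1 invf_div => young.
  have {young} := young _.
  have e : q^-1 + (q - 1) / q = 1 by field; rewrite gt_eqF.
  move=> /(_ e); rewrite mul1r -mulrDl ler_pdivlMr // mulrC; lra.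
have sumq : \sum_(i | (mag_rank u i < s)%N) (2 * s%:R * `|u i 0|) `^ q <= s%:R.
  have -> : \sum_(i | (mag_rank u i < s)%N) (2 * s%:R * `|u i 0|) `^ q =
      (2 * s%:R) `^ q * \sum_i `|largest s u i 0| `^ q.
    rewrite mulr_sumr big_mkcond; apply: eq_bigr => i _; rewrite mxE.
    case: ifP => _; first by rewrite [LHS]powRM ?mulr_ge0 ?ler0n.
    by rewrite normr0 powR0 ?mulr0 // gt_eqF.
  move: h; rewrite /= fine_invr; set S := \sum_(i < K) _.
  have S0 : 0 <= S by rewrite sumr_ge0 // => i _; rewrite powR_ge0.
  move=> h; have : (2 * s%:R * S `^ q^-1) `^ q <= (s%:R `^ q^-1) `^ q.
    rewrite ge0_ler_powR ?nnegrE ?mulr_ge0 ?powR_ge0 ?(ltW sR0) ?(ltW q0) //.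
    have := ler_wpM2l (_ : 0 <= 2 * s%:R) h; rewrite mulr_ge0 ?ler0n // => /(_ isT).
    move=> /le_trans; apply.
    rewrite powRD; last by rewrite (gt_eqF sR0) implybT.
    rewrite powR_inv1 ?ler0n //.
    have -> : 2 * s%:R * (1 / 2 * (s%:R `^ q^-1 / s%:R)) = s%:R `^ q^-1 :> R.
      by field; rewrite gt_eqF.
    exact: lexx.
  rewrite powRM ?mulr_ge0 ?powR_ge0 ?ler0n // -!powRrM mulVf ?gt_eqF //.
  by rewrite !powRr1 // ler0n.
move: (ler_sum (index_enum _) key).
rewrite -mulr_sumr !sumrB !sumc -mulr_sumr mulr1.
set T := \sum_(i | _) `|_| => k.
have : q * (2 * s%:R * T - s%:R) <= 0 by lra.
rewrite pmulr_rle0 // subr_le0 mulrAC ger_pMl //; lra.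
Qed.

(** * Distance from the identity to matrices of low rank *)

Lemma gram_unit (R : realFieldType) k n (C : 'M[R]_(k, n)) :
  row_free C -> C *m C^T \in unitmx.
Proof.
move=> Cfree; rewrite -row_free_unit -kermx_eq0; apply/eqP/row_matrixP => i.
rewrite row0; set x := row i _.
have xG : x *m (C *m C^T) = 0 by rewrite -row_mul mulmx_ker row0.
have xC : x *m C = 0.
  apply/rowP => j; rewrite [RHS]mxE; apply/eqP; rewrite -sqrf_eq0.
  have : ((x *m C) *m (x *m C)^T) 0 0 = 0.
    by rewrite trmx_mul mulmxA -(mulmxA x) xG mul0mx mxE.
  rewrite mxE; under eq_bigr do rewrite [_^T _ _]mxE -expr2.
  move/psumr_eq0P => -> //; first by move=> l _; exact: sqr_ge0.
apply: (row_free_inj Cfree); by rewrite xC mul0mx.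
Qed.

Lemma mxtrace_tr_mul (R : comPzRingType) m n (M N : 'M[R]_(m, n)) :
  \tr (M^T *m N) = \sum_i \sum_j M i j * N i j.
Proof.
rewrite /mxtrace exchange_big; apply: eq_bigr => j _; rewrite mxE.
by apply: eq_bigr => i _; rewrite mxE.
Qed.

(** The rows of [C] are a basis of the kernel of [A], and
    [P = C^T (C C^T)^-1 C] is the orthogonal projector onto it; its trace is the
    dimension of the kernel.  Both [\tr (V^T P)] and [\tr (P V)] equal [\tr P]
    since [V P = P], so [0 <= |V - P|^2] is [\tr P <= |V|^2]. *)
Lemma frobenius_ge (R : realFieldType) m n (H A : 'M[R]_(m, n)) (V : 'M[R]_n) :
  1%:M = V + H^T *m A ->
  n%:R - m%:R <= \sum_i \sum_j V i j ^+ 2.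
Proof.
move=> dec; pose C := row_base (kermx A^T).
have CA : A *m C^T = 0.
  apply: trmx_inj; rewrite trmx_mul trmxK trmx0.
  by apply/sub_kermxP; rewrite eq_row_base.
have U : C *m C^T \in unitmx by apply: gram_unit; exact: row_base_free.
move: C CA U => C CA U.
pose P := C^T *m invmx (C *m C^T) *m C.
have trP : \tr P = (\rank (kermx A^T))%:R.
  by rewrite /P mxtrace_mulC mulmxA mulmxV // mxtrace1.
have Psym : P^T = P.
  by rewrite /P !trmx_mul trmx_inv !trmx_mul trmxK mulmxA.
have PP : P *m P = P.
  by rewrite /P -!mulmxA (mulmxA C) mulKmx.
have VP : V *m P = P.
  have -> : V = 1%:M - H^T *m A by rewrite dec addrK.
  by rewrite mulmxBl mul1mx /P -!mulmxA (mulmxA A) CA mul0mx mulmx0 subr0.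
have k : (n%:R - m%:R <= (\rank (kermx A^T))%:R :> R).
  rewrite mxrank_ker mxrank_tr lerBlDr -natrD ler_nat.
  have := rank_leq_row A; lia.
apply: le_trans k _; rewrite -trP.
have : 0 <= \tr ((V - P)^T *m (V - P)).
  rewrite mxtrace_tr_mul; do 2! apply: sumr_ge0 => ? _.
  by rewrite -expr2 sqr_ge0.
have -> : (V - P)^T = V^T - P by rewrite linearB /= Psym.
rewrite mulmxBl !mulmxBr PP !(raddfB (@mxtrace R n)) /=.
have -> : \tr (V^T *m P) = \tr P.
  by rewrite -mxtrace_tr trmx_mul trmxK Psym mxtrace_mulC VP.
rewrite (mxtrace_mulC P) VP mxtrace_tr_mul.
have -> : \sum_i \sum_j V i j * V i j = \sum_i \sum_j V i j ^+ 2 by [].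
lra.
Qed.

(** * Comparison on the leading blocks *)

Lemma sum_block_index (R : nmodType) k d (F : 'I_(k * d) -> R) :
  \sum_i F i = \sum_(a < k) \sum_(b < d) F (block_index a b).
Proof.
rewrite pair_big /= (reindex (fun p : 'I_k * 'I_d => block_index p.1 p.2)) //=.
apply/onW_bij/inj_card_bij; last by rewrite card_prod !card_ord.
move=> [a b] [a' b'] /(congr1 val) /= e.
have d0 : (0 < d)%N by exact: leq_ltn_trans (ltn_ord b).
congr (_, _); apply: val_inj => /=.
  move: (congr1 (divn^~ d) e).
  by rewrite !divnMDl // !divn_small // !addn0.
by move: (congr1 (modn^~ d) e); rewrite !modnMDl !modn_small.
Qed.

(** A principal submatrix of [V] is again the identity minus a product through
    dimension [m], obtained from the corresponding columns of [H] and [A], so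
    [frobenius_ge] applies to it with the same [m].  The upper bound for each block
    column uses only [k] of its [K] entries. *)
Lemma leading_blocks_bound (R : realType) (m K d : nat) (r : \bar R) (s : nat)
    (A H : 'M[R]_(m, K * d)) (V : 'M[R]_(K * d)) k :
  r = 1%:E \/ r = 2%:E \/ r = +oo%E -> (0 < s)%N -> (s <= K)%N -> (k <= K)%N ->
  1%:M = V + H^T *m A ->
  (forall l : 'I_K, let u := \col_(i < K) opnorm r (block V i l) in
     \sum_(i | (mag_rank u i < s)%N) `|u i 0| <= 1 / 2) ->
  (k * d)%:R - m%:R <= (k * d)%:R * (1 / 4 + k%:R / (4 * s%:R ^+ 2)) :> R.
Proof.
move=> r_spec s0 sK kK dec top.
have kdKd : (k * d <= K * d)%N by rewrite leq_mul2r kK orbT.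
pose f := widen_ord kdKd.
have fE a b : f (block_index a b) = block_index (widen_ord kK a) b.
  exact: val_inj.
have dec' : 1%:M = mxsub f f V + (colsub f H)^T *m colsub f A.
  have -> : 1%:M = mxsub f f (1%:M : 'M[R]_(K * d)).
    by apply/matrixP => i j; rewrite !mxE; congr (_%:R).
  apply/matrixP => i j; rewrite dec !mxE; congr (_ + _).
  by apply: eq_bigr => l _; rewrite !mxE.
apply: le_trans (frobenius_ge dec') _.
rewrite exchange_big sum_block_index natrM -mulrA.
have cst c : k%:R * c = \sum_(i < k) c :> R by rewrite sumr_const card_ord mulr_natl.
rewrite cst; apply: ler_sum => l _.
set l' := widen_ord kK l; set u : 'cV[R]_K := \col_(i < K) opnorm r (block V i l').
apply: le_trans (_ : \sum_(a < k) d%:R * u (widen_ord kK a) 0 ^+ 2 <= _).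
  under eq_bigr do rewrite sum_block_index.
  rewrite exchange_big; apply: ler_sum => a _.
  rewrite mxE; apply: le_trans (frobenius_le_opnorm _ r_spec).
  rewrite exchange_big; apply: ler_sum => b _; apply: ler_sum => c _.
  by rewrite !mxE !fE.
rewrite -mulr_sumr ler_wpM2l ?ler0n //.
rewrite -(big_ord_narrow (F := fun i => u i 0 ^+ 2) kK).
apply: le_trans (sum_sqr_le_largest _ s0 sK (top l')) _.
by rewrite lerD2l -sum1_card (big_ord_narrow kK) sum1_card card_ord.
Qed.

Theorem proposition5p3 (R : realType) (m K d : nat)
    (d_gt0 : (0 < d)%N) (le_2m_n : (2 * m <= K * d)%N)
    (A : 'M[R]_(m, K * d))
    (r : \bar R) (r_spec : r = 1%:E \/ r = 2%:E \/ r = +oo%E)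
    (s : nat) (s_gt0 : (0 < s)%N) (le_s_K : (s <= K)%N)
    (H : 'M[R]_(m, K * d)) (V : 'M[R]_(K * d))
    (q : \bar R) (q_ge1 : (1 <= q)%E)
    (decomp : 1%:M = V + H^T *m A)
    (cond : \big[Num.max/0]_(l < K)
              sqnorm s q (\col_(k < K) opnorm r (block V k l))
            <= 1 / 2 * s%:R `^ (fine q^-1%E - 1)) :
  s%:R <= (3 * Num.sqrt m%:R) / (2 * Num.sqrt d%:R) :> R.
Proof.
have top l : let u := \col_(i < K) opnorm r (block V i l) in
    \sum_(i | (mag_rank u i < s)%N) `|u i 0| <= 1 / 2.
  apply: (sum_largest_le q_ge1) => //; apply: le_trans cond.
  exact: (le_bigmax 0 (fun l => sqnorm s q (\col_(k < K) opnorm r (block V k l)))).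
have bound k (kK : (k <= K)%N) :=
  leading_blocks_bound r_spec s_gt0 le_s_K kK decomp top.
have s1 : 1 <= s%:R :> R by rewrite ler1n.
have sR0 : 0 < s%:R :> R by rewrite ltr0n.
have d0 : 0 < d%:R :> R by rewrite ltr0n.
have d_le : (d <= 2 * m)%N.
  rewrite -(ler_nat R) natrM.
  have := bound 1%N (leq_trans s_gt0 le_s_K); rewrite mul1n => b.
  have : 1 / (4 * s%:R ^+ 2) <= 1 / 4 :> R.
    by rewrite ler_pM2l // lef_pV2 ?posrE ?mulr_gt0 ?exprn_gt0 // ler_peMr // exprn_ege1.
  move=> /(ler_wpM2l (ltW d0)); lra.
have [k [lo hi kK]] : exists k, [/\ (2 * m <= k * d)%N, (k * d <= 4 * m)%N
    & (k <= K)%N].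
  (* the ceiling of 2m / d; rounding adds less than d, and d <= 2m *)
  exists ((2 * m + d.-1) %/ d)%N.
  have := divn_eq (2 * m + d.-1) d; have := ltn_pmod (2 * m + d.-1) d_gt0.
  set k := (_ %/ _)%N => e1 e2.
  have lo : (2 * m <= k * d)%N by lia.
  have hi : (k * d < 2 * m + d)%N by lia.
  split=> //; first by lia.
  rewrite -ltnS -(ltn_pmul2r d_gt0) mulSn; lia.
have m0 : 0 < m%:R :> R by rewrite ltr0n; lia.
have {bound} := bound k kK.
move: lo hi; rewrite -!(ler_nat R) !natrM.
set n := k%:R * d%:R => lo hi b.
have {b} b : s%:R ^+ 2 * d%:R * (3 * n - 4 * m%:R) <= n ^+ 2.
  have := ler_wpM2l (_ : 0 <= 4 * s%:R ^+ 2 * d%:R) b.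
  rewrite !mulr_ge0 ?exprn_ge0 ?(ltW sR0) ?(ltW d0) // => /(_ isT).
  have -> : 4 * s%:R ^+ 2 * d%:R * (n * (1 / 4 + k%:R / (4 * s%:R ^+ 2))) =
     s%:R ^+ 2 * d%:R * n + n ^+ 2 by rewrite /n; field; rewrite gt_eqF.
  lra.
have main : 4 * (s%:R ^+ 2 * d%:R) <= 9 * m%:R :> R.
  have p : 0 < 3 * n - 4 * m%:R by lra.
  (* (n - 2m)(4m - n) >= 0 gives 4n^2 <= 9m(3n - 4m) on [2m, 4m] *)
  rewrite -(ler_pM2r p) -mulrA; nra.
rewrite ler_pdivlMr ?mulr_gt0 ?sqrtr_gt0 //.
rewrite -(@ler_pXn2r _ 2) ?nnegrE ?mulr_ge0 ?sqrtr_ge0 ?ler0n //.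
rewrite !exprMn !sqr_sqrtr ?ler0n //; lra.
Qed.
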